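(* Let $X,\tilde X$ be limit spaces and let $p:(\tilde X,\tilde x_0)\to(X,x_0)$ be a fibration with unique path lifting. Let $Y$ be a connected locally path-connected limit space and $y_0\in Y$. A continuous map $f:(Y,y_0)\to(X,x_0)$ has a lifting $f':(Y,y_0)\to(\tilde X,\tilde x_0)$ (a continuous map with $pf'=f$ and $f'(y_0)=\tilde x_0$) if and only if, in $\pi(X,x_0)$, $$f_\#\pi(Y,y_0)\subset p_\#\pi(\tilde X,\tilde x_0).$$
   Context: Filters: a filter on a set $X$ is a non-empty collection of subsets of $X$, not containing $\emptyset$, closed under supersets and finite intersections. $[x]$ is the filter of all sets containing $x$. For a map $f$, $f(\mathcal{F})$ is the filter generated by $\{f(A):A\in\mathcal{F}\}$. A limit space is a set $X$ with, for each $x\in X$, a set of filters on $X$ said to converge to $x$ (written $\mathcal{F}\to x$) such that $[x]\to x$; if $\mathcal{F},\mathcal{G}\to x$ then $\mathcal{F}\cap\mathcal{G}\to x$; if $\mathcal{F}\to x$ and $\mathcal{G}\supset\mathcal{F}$ is a filter then $\mathcal{G}\to x$. A map $f:X\to Y$ of limit spaces is continuous if $\mathcal{F}\to x$ implies $f(\mathcal{F})\to f(x)$. Topological spaces are limit spaces via convergence of filters; $I=[0,1]$ carries the usual topology. Subspaces and products carry the initial limit structure ($\mathcal{F}\to x$ iff its images under the inclusion, resp. under all projections, converge to the image of $x$). A covering system of $X$ is a collection $\mathcal{U}$ of subsets of $X$ such that for every $x\in X$ and every $\mathcal{F}\to x$, $\mathcal{U}\cap\mathcal{F}\neq\emptyset$.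 $X$ is disconnected if $X=A\cup B$ with $A,B$ non-empty and disjoint and there is a covering system of $X$ each of whose members is contained in $A$ or in $B$; otherwise $X$ is connected. $X$ is path-connected if any two points are joined by a continuous $\gamma:I\to X$. A local covering system base of $X$ at $x$ is a collection $\mathcal{B}$ of subsets of $X$ such that for every $\mathcal{H}\to x$ there is $\mathcal{F}\to x$ with $\mathcal{F}\subset\mathcal{H}$ such that every $A\in\mathcal{F}$ contains some $B\in\mathcal{B}\cap\mathcal{F}$. $X$ is locally path-connected if every $x\in X$ has a local covering system base all of whose members are path-connected (as subspaces). A continuous map $p:E\to B$ is a fibration if for every limit space $Z$ and all continuous $f':Z\to E$, $F:Z\times I\to B$ with $F(z,0)=pf'(z)$ there is a continuous $F':Z\times I\to E$ with $F'(z,0)=f'(z)$ and $pF'=F$. It has unique path lifting if any two paths $\omega,\omega':I\to E$ with $p\omega=p\omega'$ and $\omega(0)=\omega'(0)$ are equal. $\pi(X,x)$ is the fundamental group of based homotopy classes of loops at $x$ (homotopies being continuous maps out of products with $I$), and $g_\#$ denotes the homomorphism induced by $g$. *)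

(* Defs.v *)
From HB Require Import structures.
From mathcomp Require Import all_boot all_order all_algebra.
From mathcomp Require Import monoid generic_quotient.
From mathcomp Require Import lra.
From mathcomp Require Import boolp classical_sets functions filter reals.
From mathcomp Require Import topology normedtype.

Set Implicit Arguments.
Unset Strict Implicit.
Unset Printing Implicit Defensive.

Import Order.TTheory GRing.Theory Num.Theory.
Import numFieldNormedType.Exports.

Local Open Scope classical_set_scope.
Local Open Scope ring_scope.
Local Open Scope quotient_scope.

(* A filter in the sense used here never contains the empty set, so only
   [ProperFilter]s converge. *)
HB.mixin Record isLimitSpace X := {
  converges : set_system X -> X -> Prop;
  converges_proper : forall F x, converges F x -> ProperFilter F;
  converges_principal : forall x, converges (principal_filter x) x;
  converges_cap : forall F G x,
    converges F x -> converges G x -> converges (F `&` G) x;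
  converges_finer : forall F G x,
    converges F x -> ProperFilter G -> F `<=` G -> converges G x
}.

#[short(type="limitSpaceType")]
HB.structure Definition LimitSpace := {X of isLimitSpace X}.

Arguments converges_proper {s F x}.
Arguments converges_principal {s}.
Arguments converges_cap {s F G x}.
Arguments converges_finer {s F G x}.

(* [fmap f F], the sets whose preimage lies in [F], is the filter generated by
   the direct images of the members of [F]. *)
Definition lim_continuous (X Y : limitSpaceType) (f : X -> Y) :=
  forall F x, converges F x -> converges (fmap f F) (f x).

Lemma proper_cap (T : Type) (F G : set_system T) :
  ProperFilter F -> ProperFilter G -> ProperFilter (F `&` G).
Proof.
move=> [F0 FF] [G0 GF]; split; first by case.
split; first by split; exact: filterT.
- by move=> A B [FA GA] [FB GB]; split; exact: filterI.
- by move=> A B AB [FA GA]; split; apply: filterS AB _.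
Qed.

Lemma proper_fmap (T U : Type) (f : T -> U) (F : set_system T) :
  ProperFilter F -> ProperFilter (fmap f F).
Proof. by move=> FF; exact: fmap_proper_filter. Qed.

Section product.
Variables X Y : limitSpaceType.

Definition prod_converges (F : set_system (X * Y)) (z : X * Y) :=
  [/\ ProperFilter F, converges (fmap fst F) z.1 & converges (fmap snd F) z.2].

Fact prod_converges_proper F z : prod_converges F z -> ProperFilter F.
Proof. by case. Qed.

Fact prod_converges_principal z : prod_converges (principal_filter z) z.
Proof.
split; first exact: principal_filter_proper.
- apply: converges_finer (converges_principal z.1) _ _.
    exact/proper_fmap/principal_filter_proper.
  by move=> A Az w /= ->; exact: Az.
- apply: converges_finer (converges_principal z.2) _ _.
    exact/proper_fmap/principal_filter_proper.
  by move=> A Az w /= ->; exact: Az.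
Qed.

Fact prod_converges_cap F G z :
  prod_converges F z -> prod_converges G z -> prod_converges (F `&` G) z.
Proof.
by move=> [F0 F1 F2] [G0 G1 G2]; split;
  [exact: proper_cap | exact: converges_cap F1 G1 | exact: converges_cap F2 G2].
Qed.

Fact prod_converges_finer F G z :
  prod_converges F z -> ProperFilter G -> F `<=` G -> prod_converges G z.
Proof.
move=> [F0 F1 F2] G0 FG; split=> //.
- by apply: converges_finer F1 (proper_fmap _ G0) _ => A; exact: FG.
- by apply: converges_finer F2 (proper_fmap _ G0) _ => A; exact: FG.
Qed.

HB.instance Definition _ := isLimitSpace.Build (X * Y)%type
  prod_converges_proper prod_converges_principal
  prod_converges_cap prod_converges_finer.
End product.

Section subspace.
Variables (X : limitSpaceType) (A : set X).

Definition sub_converges (F : set_system (set_type A)) (x : set_type A) :=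
  ProperFilter F /\ converges (fmap val F) (val x).

Fact sub_converges_proper F x : sub_converges F x -> ProperFilter F.
Proof. by case. Qed.

Fact sub_converges_principal x : sub_converges (principal_filter x) x.
Proof.
split; first exact: principal_filter_proper.
apply: converges_finer (converges_principal (val x)) _ _.
  exact/proper_fmap/principal_filter_proper.
by move=> B Bx w /= ->; exact: Bx.
Qed.

Fact sub_converges_cap F G x :
  sub_converges F x -> sub_converges G x -> sub_converges (F `&` G) x.
Proof.
by move=> [F0 F1] [G0 G1]; split;
  [exact: proper_cap | exact: converges_cap F1 G1].
Qed.

Fact sub_converges_finer F G x :
  sub_converges F x -> ProperFilter G -> F `<=` G -> sub_converges G x.
Proof.
move=> [F0 F1] G0 FG; split=> //.
by apply: converges_finer F1 (proper_fmap _ G0) _ => B; exact: FG.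
Qed.

HB.instance Definition _ := isLimitSpace.Build (set_type A)
  sub_converges_proper sub_converges_principal
  sub_converges_cap sub_converges_finer.
End subspace.

(* The limit structure of a topological space is put on an alias, so that it
   cannot compete with the ones on products and subsets. *)
Definition top_limit (T : Type) : Type := T.

Section topological.
Variable T : topologicalType.

Definition top_converges (F : set_system (top_limit T)) (x : top_limit T) :=
  ProperFilter F /\ (F : set_system T) --> (x : T).

Fact top_converges_proper F x : top_converges F x -> ProperFilter F.
Proof. by case. Qed.

Fact top_converges_principal x : top_converges (principal_filter x) x.
Proof.
split; first exact: principal_filter_proper.
by move=> A Ax w /= ->; exact: nbhs_singleton Ax.
Qed.

Fact top_converges_cap F G x :
  top_converges F x -> top_converges G x -> top_converges (F `&` G) x.
Proof.
move=> [F0 F1] [G0 G1]; split; first exact: proper_cap.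
by move=> A Ax; split; [exact: F1 | exact: G1].
Qed.

Fact top_converges_finer F G x :
  top_converges F x -> ProperFilter G -> F `<=` G -> top_converges G x.
Proof. by move=> [F0 F1] G0 FG; split=> // A Ax; exact/FG/F1. Qed.

HB.instance Definition _ := isLimitSpace.Build (top_limit T)
  top_converges_proper top_converges_principal
  top_converges_cap top_converges_finer.
End topological.

Definition unit_interval (R : realType) : Type :=
  set_type ([set x | 0 <= x <= 1] : set (top_limit R)).

HB.instance Definition _ (R : realType) := LimitSpace.copy (unit_interval R)
  (set_type ([set x | 0 <= x <= 1] : set (top_limit R))).

Definition ui_val (R : realType) (t : unit_interval R) : R := val t.

(* The retraction of the line onto the interval. *)
Fact ui_clamp_subproof (R : realType) (r : R) :
  Num.max 0 (Num.min 1 r) \in [set x : R | 0 <= x <= 1].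
Proof. by rewrite inE /= le_max lexx ge_max ler01 ge_min lexx. Qed.

Definition ui_clamp (R : realType) (r : R) : unit_interval R :=
  exist (fun x => x \in [set x : top_limit R | 0 <= x <= 1]) _
    (ui_clamp_subproof r).

Definition ui0 (R : realType) : unit_interval R := ui_clamp 0.
Definition ui1 (R : realType) : unit_interval R := ui_clamp 1.
Arguments ui0 {R}.
Arguments ui1 {R}.

Section unit_interval_theory.
Variable R : realType.
Implicit Types (r : R) (t : unit_interval R).

Lemma ui_val_bounds t : 0 <= ui_val t <= 1.
Proof. by have := valP t; rewrite inE. Qed.

Lemma ui_clampE r : 0 <= r <= 1 -> ui_val (ui_clamp r) = r.
Proof.
by move=> /andP[r0 r1]; rewrite /ui_val /= (min_idPr r1) (max_idPr r0).
Qed.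

Lemma ui_val_inj : injective (@ui_val R).
Proof. exact: val_inj. Qed.

Lemma ui_valK t : ui_clamp (ui_val t) = t.
Proof. exact/ui_val_inj/ui_clampE/ui_val_bounds. Qed.

Lemma ui_val0 : ui_val (@ui0 R) = 0.
Proof. by rewrite ui_clampE// lexx ler01. Qed.

Lemma ui_val1 : ui_val (@ui1 R) = 1.
Proof. by rewrite ui_clampE// lexx ler01. Qed.

Lemma ui_clamp_le0 r : r <= 0 -> ui_clamp r = ui0.
Proof.
move=> r0; apply/ui_val_inj; rewrite ui_val0 /ui_val /=.
by apply/max_idPl; rewrite ge_min r0 orbT.
Qed.

Lemma ui_clamp_ge1 r : 1 <= r -> ui_clamp r = ui1.
Proof.
move=> r1; apply/ui_val_inj; rewrite ui_val1 /ui_val /= (min_idPl r1).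
exact/max_idPr/ler01.
Qed.
End unit_interval_theory.

Section continuity.
Implicit Types X Y Z : limitSpaceType.

Lemma lim_continuous_id X : lim_continuous (@id X).
Proof. by []. Qed.

Lemma lim_continuous_cst X Y (y : Y) : lim_continuous (fun _ : X => y).
Proof.
move=> F x Fx; have FF := converges_proper Fx.
apply: converges_finer (converges_principal y) (proper_fmap _ FF) _ => A Ay.
apply: (@filterS _ F _ setT) => [z _|]; [exact: Ay | exact: filterT].
Qed.

Lemma lim_continuous_comp X Y Z (f : X -> Y) (g : Y -> Z) :
  lim_continuous f -> lim_continuous g -> lim_continuous (g \o f).
Proof. by move=> fc gc F x Fx; exact: gc (fc _ _ Fx). Qed.

Lemma lim_continuous_fst X Y : lim_continuous (@fst X Y).
Proof. by move=> F x []. Qed.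

Lemma lim_continuous_snd X Y : lim_continuous (@snd X Y).
Proof. by move=> F x []. Qed.

Lemma lim_continuous_pair X Y Z (f : Z -> X) (g : Z -> Y) :
  lim_continuous f -> lim_continuous g -> lim_continuous (fun z => (f z, g z)).
Proof.
move=> fc gc F z Fz; split; [|exact: fc|exact: gc].
exact: proper_fmap (converges_proper Fz).
Qed.

Lemma lim_continuous_val X (A : set X) :
  lim_continuous (val : set_type A -> X).
Proof. by move=> F x []. Qed.

Lemma lim_continuous_sub X Y (A : set X) (f : Y -> set_type A) :
  lim_continuous (fun y => val (f y)) -> lim_continuous f.
Proof.
move=> fc F y Fy; split; last exact: fc.
exact: proper_fmap (converges_proper Fy).
Qed.

Variable R : realType.

Lemma lim_continuous_realP X (u : X -> top_limit R) :
  lim_continuous u <->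
  forall F x, converges F x -> (u : X -> R) x @[x --> F] --> (u x : R).
Proof.
split=> uc F x Fx; first by case: (uc _ _ Fx).
split; last exact: uc.
exact: proper_fmap (converges_proper Fx).
Qed.

Lemma lim_continuous_uival :
  lim_continuous (@ui_val R : unit_interval R -> top_limit R).
Proof. exact: lim_continuous_val. Qed.

Lemma lim_continuous_add X (u v : X -> top_limit R) :
  lim_continuous u -> lim_continuous v ->
  lim_continuous (fun x => ((u x : R) + (v x : R)) : top_limit R).
Proof.
move=> /lim_continuous_realP uc /lim_continuous_realP vc.
apply/lim_continuous_realP => F x Fx; have FF := converges_proper Fx.
exact: cvgD (uc _ _ Fx) (vc _ _ Fx).
Qed.

Lemma lim_continuous_mul X (u v : X -> top_limit R) :
  lim_continuous u -> lim_continuous v ->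
  lim_continuous (fun x => ((u x : R) * (v x : R)) : top_limit R).
Proof.
move=> /lim_continuous_realP uc /lim_continuous_realP vc.
apply/lim_continuous_realP => F x Fx; have FF := converges_proper Fx.
exact: cvgM (uc _ _ Fx) (vc _ _ Fx).
Qed.

Lemma lim_continuous_opp X (u : X -> top_limit R) :
  lim_continuous u -> lim_continuous (fun x => (- (u x : R)) : top_limit R).
Proof.
move=> /lim_continuous_realP uc.
apply/lim_continuous_realP => F x Fx; have FF := converges_proper Fx.
exact: cvgN (uc _ _ Fx).
Qed.

Lemma lim_continuous_norm X (u : X -> top_limit R) :
  lim_continuous u -> lim_continuous (fun x => `|(u x : R)| : top_limit R).
Proof.
move=> /lim_continuous_realP uc.
apply/lim_continuous_realP => F x Fx; have FF := converges_proper Fx.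
exact: cvg_norm (uc _ _ Fx).
Qed.

(* No covering argument is needed: the image of a filter under the glued map
   is finer than the intersection of its images under the two pieces. *)
Lemma lim_continuous_glue X Y (u v : X -> top_limit R) (f g : X -> Y) :
  lim_continuous u -> lim_continuous v -> lim_continuous f ->
  lim_continuous g -> (forall x, u x = v x -> f x = g x) ->
  lim_continuous (fun x => if (u x : R) <= v x then f x else g x).
Proof.
move=> uc vc fc gc fg F x Fx; have FF := converges_proper Fx.
have wc : (fun y => (v y : R) - u y) @ F --> (v x : R) - u x.
  exact: (lim_continuous_realP _).1
    (lim_continuous_add vc (lim_continuous_opp uc)) _ _ Fx.
have kF := proper_fmap (fun x => if (u x : R) <= v x then f x else g x) FF.
have [xlt|xgt|xeq] := ltgtP (u x : R) (v x).
- apply: converges_finer (fc _ _ Fx) kF _ => A fA.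
  have w0 : \forall y \near F, 0 < (v y : R) - u y.
    have w1 : 0 < (v x : R) - u x by rewrite subr_gt0.
    exact: (@cvgr_gt _ _ _ _ _ _ wc 0 w1).
  apply: (@filterS2 _ F _ _ _ _ _ fA w0) => y Ay.
  by rewrite subr_gt0 => /ltW yle; rewrite /preimage /= yle.
- apply: converges_finer (gc _ _ Fx) kF _ => A gA.
  have w0 : \forall y \near F, (v y : R) - u y < 0.
    have w1 : (v x : R) - u x < 0 by rewrite subr_lt0.
    exact: (@cvgr_lt _ _ _ _ _ _ wc 0 w1).
  apply: (@filterS2 _ F _ _ _ _ _ gA w0) => y Ay.
  by rewrite subr_lt0 => ylt; rewrite /preimage /= leNgt ylt.
- have gx : converges (fmap g F) (f x) by rewrite (fg _ xeq); exact: gc.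
  apply: converges_finer (converges_cap (fc _ _ Fx) gx) kF _ => A [fA gA].
  apply: (@filterS2 _ F _ _ _ _ _ fA gA) => y fy gy.
  by rewrite /preimage /=; case: ifP.
Qed.

Lemma lim_continuous_clamp X (u : X -> top_limit R) :
  lim_continuous u -> lim_continuous (fun x => ui_clamp (u x : R)).
Proof.
move=> uc; apply: lim_continuous_sub => /=.
have -> : (fun x => Num.max 0 (Num.min 1 (u x : R)) : top_limit R) =
    (fun x => if (u x : R) <= 0 then 0 else
              if 1 <= (u x : R) then 1 else u x).
  apply/funext => x; case: (leP (u x : R) 0) => [x0|x0].
    by apply/max_idPl; rewrite ge_min x0 orbT.
  case: leP => [x1|x1]; first exact/max_idPr/ler01.
  exact/max_idPr/ltW.
apply: (lim_continuous_glue (v := fun=> 0)) => //;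
  do ?exact: lim_continuous_cst.
- apply: (lim_continuous_glue (u := fun=> 1)) => //;
  exact: lim_continuous_cst.
- by move=> x ->; rewrite leNgt ltr01.
Qed.
End continuity.

Definition covering_system (X : limitSpaceType) (U : set_system X) :=
  forall (x : X) (F : set_system X), converges F x -> U `&` F !=set0.

Definition lim_disconnected (X : limitSpaceType) :=
  exists A B : set X, [/\ A !=set0, B !=set0, A `&` B = set0, A `|` B = setT &
    exists2 U : set_system X, covering_system U &
      forall C, U C -> C `<=` A \/ C `<=` B].

Definition lim_connected (X : limitSpaceType) := ~ lim_disconnected X.

Definition lim_path_connected (R : realType) (X : limitSpaceType) :=
  forall x y : X, exists g : unit_interval R -> X,
    [/\ lim_continuous g, g ui0 = x & g ui1 = y].

Definition local_covering_base (X : limitSpaceType) (x : X)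
    (B : set_system X) :=
  forall H, converges H x -> exists F, [/\ converges F x, F `<=` H &
    forall A, F A -> exists C, [/\ B C, F C & C `<=` A]].

Definition lim_locally_path_connected (R : realType) (X : limitSpaceType) :=
  forall x : X, exists2 B : set_system X, local_covering_base x B &
    forall C, B C -> lim_path_connected R (set_type C).

Definition lim_fibration (R : realType) (E B : limitSpaceType) (p : E -> B) :=
  lim_continuous p /\
  forall (Z : limitSpaceType) (f : Z -> E) (F : Z * unit_interval R -> B),
    lim_continuous f -> lim_continuous F ->
    (forall z, F (z, ui0) = p (f z)) ->
    exists F' : Z * unit_interval R -> E, [/\ lim_continuous F',
      forall z, F' (z, ui0) = f z & forall w, p (F' w) = F w].

Definition unique_path_lifting (R : realType) (E B : limitSpaceType)
    (p : E -> B) :=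
  forall w w' : unit_interval R -> E, lim_continuous w -> lim_continuous w' ->
    p \o w = p \o w' -> w ui0 = w' ui0 -> w = w'.

Record based_map (X Y : limitSpaceType) (x : X) (y : Y) := BasedMap {
  based_fun :> X -> Y;
  based_continuous : lim_continuous based_fun;
  based_point : based_fun x = y
}.

Record loop (R : realType) (X : limitSpaceType) (x : X) := Loop {
  loop_fun :> unit_interval R -> X;
  loop_continuous : lim_continuous loop_fun;
  loop_source : loop_fun ui0 = x;
  loop_target : loop_fun ui1 = x
}.

HB.instance Definition _ R X x := gen_eqMixin (@loop R X x).
HB.instance Definition _ R X x := gen_choiceMixin (@loop R X x).

Definition loop_homotopic (R : realType) (X : limitSpaceType) (x : X)
    (l m : loop R x) :=
  exists H : unit_interval R * unit_interval R -> X,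
    [/\ lim_continuous H,
        forall s, H (s, ui0) = l s, forall s, H (s, ui1) = m s &
        forall t, H (ui0, t) = x /\ H (ui1, t) = x].

Section loops.
Variables (R : realType) (X : limitSpaceType) (x : X).
Implicit Types l m n : loop R x.

Definition loop_cst : loop R x :=
  Loop (@lim_continuous_cst (unit_interval R) X x) erefl erefl.

Let aff_cont (c : R) (Z : limitSpaceType) (u : Z -> unit_interval R) (d : R) :
  lim_continuous u -> lim_continuous (fun z => ui_clamp (c * ui_val (u z) + d)).
Proof.
move=> uc; apply: lim_continuous_clamp; apply: lim_continuous_add;
  last exact: lim_continuous_cst.
apply: lim_continuous_mul; first exact: lim_continuous_cst.
exact: lim_continuous_comp uc (@lim_continuous_uival R).
Qed.

Let scale_cont (c : R) (Z : limitSpaceType) (u : Z -> unit_interval R) :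
  lim_continuous u -> lim_continuous (fun z => ui_clamp (c * ui_val (u z))).
Proof.
move=> uc; apply: lim_continuous_clamp.
apply: lim_continuous_mul; first exact: lim_continuous_cst.
exact: lim_continuous_comp uc (@lim_continuous_uival R).
Qed.

Definition loop_inv_fun l (s : unit_interval R) := l (ui_clamp (1 - ui_val s)).

Fact loop_inv_continuous l : lim_continuous (loop_inv_fun l).
Proof.
apply: lim_continuous_comp (@loop_continuous _ _ _ l).
apply: lim_continuous_clamp; apply: lim_continuous_add.
  exact: lim_continuous_cst.
exact/lim_continuous_opp/lim_continuous_uival.
Qed.

Fact loop_inv_source l : loop_inv_fun l ui0 = x.
Proof. by rewrite /loop_inv_fun ui_val0 subr0 loop_target. Qed.

Fact loop_inv_target l : loop_inv_fun l ui1 = x.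
Proof. by rewrite /loop_inv_fun ui_val1 subrr loop_source. Qed.

Definition loop_inv l : loop R x :=
  Loop (@loop_inv_continuous l) (loop_inv_source l) (loop_inv_target l).

Definition loop_cat_fun l m (s : unit_interval R) :=
  if ui_val s <= 2^-1 then l (ui_clamp (2 * ui_val s))
  else m (ui_clamp (2 * ui_val s - 1)).

Fact loop_cat_continuous l m : lim_continuous (loop_cat_fun l m).
Proof.
apply: (lim_continuous_glue (u := @ui_val R) (v := fun=> 2^-1)).
- exact: lim_continuous_uival.
- exact: lim_continuous_cst.
- have c2 := scale_cont 2 (@lim_continuous_id (unit_interval R)).
  exact: lim_continuous_comp c2 (@loop_continuous _ _ _ l).
- have c2 := aff_cont 2 (- 1) (@lim_continuous_id (unit_interval R)).
  exact: lim_continuous_comp c2 (@loop_continuous _ _ _ m).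
- by move=> s /= ->; rewrite divff ?pnatr_eq0// subrr loop_target loop_source.
Qed.

Fact loop_cat_source l m : loop_cat_fun l m ui0 = x.
Proof. by rewrite /loop_cat_fun ui_val0 invr_ge0 ler0n mulr0 loop_source. Qed.

Fact loop_cat_target l m : loop_cat_fun l m ui1 = x.
Proof.
rewrite /loop_cat_fun ui_val1 ifF ?mulr1; last by apply/negbTE; lra.
by rewrite ui_clamp_ge1 ?loop_target//; lra.
Qed.

Definition loop_cat l m : loop R x :=
  Loop (@loop_cat_continuous l m) (loop_cat_source l m) (loop_cat_target l m).

Lemma loop_homotopic_refl l : loop_homotopic l l.
Proof.
exists (fun w => l w.1); split=> //; last first.
  by move=> t; rewrite loop_source loop_target.
exact: lim_continuous_comp (@lim_continuous_fst _ _) (@loop_continuous _ _ _ l).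
Qed.

Lemma loop_homotopic_sym l m : loop_homotopic l m -> loop_homotopic m l.
Proof.
move=> [H [Hc H0 H1 Hb]]; exists (fun w => H (w.1, ui_clamp (1 - ui_val w.2))).
split=> //.
- apply: lim_continuous_comp Hc; apply: lim_continuous_pair.
    exact: lim_continuous_fst.
  apply: lim_continuous_clamp; apply: lim_continuous_add.
    exact: lim_continuous_cst.
  apply: lim_continuous_opp.
  exact: lim_continuous_comp (@lim_continuous_snd _ _)
    (@lim_continuous_uival R).
- by move=> s /=; rewrite ui_val0 subr0.
- by move=> s /=; rewrite ui_val1 subrr.
Qed.

Lemma loop_homotopic_trans m l n :
  loop_homotopic l m -> loop_homotopic m n -> loop_homotopic l n.
Proof.
move=> [H [Hc H0 H1 Hb]] [K [Kc K0 K1 Kb]].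
exists (fun w => if ui_val w.2 <= 2^-1 then H (w.1, ui_clamp (2 * ui_val w.2))
                 else K (w.1, ui_clamp (2 * ui_val w.2 - 1))).
split.
- apply: (lim_continuous_glue (u := fun w => ui_val w.2) (v := fun=> 2^-1)).
  + exact: lim_continuous_comp (@lim_continuous_snd _ _)
      (@lim_continuous_uival R).
  + exact: lim_continuous_cst.
  + apply: lim_continuous_comp Hc; apply: lim_continuous_pair.
      exact: lim_continuous_fst.
    exact: (scale_cont 2 (@lim_continuous_snd _ _)).
  + apply: lim_continuous_comp Kc; apply: lim_continuous_pair.
      exact: lim_continuous_fst.
    exact: (aff_cont 2 (- 1) (@lim_continuous_snd _ _)).
  + by move=> w /= ->; rewrite divff ?pnatr_eq0// subrr H1 K0.
- by move=> s /=; rewrite ui_val0 invr_ge0 ler0n mulr0 H0.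
- move=> s /=; rewrite ui_val1 ifF ?mulr1; last by apply/negbTE; lra.
  by rewrite ui_clamp_ge1 ?K1//; lra.
- by move=> t /=; case: ifP => _.
Qed.

(* Reparametrizations with the same end points are homotopic, the interval
   being convex. *)
Lemma loop_reparam (k : loop R x) (f g : unit_interval R -> unit_interval R)
    l m : lim_continuous f -> lim_continuous g ->
  f ui0 = g ui0 -> f ui1 = g ui1 -> l =1 k \o f -> m =1 k \o g ->
  loop_homotopic l m.
Proof.
move=> fc gc fg0 fg1 lE mE.
pose h w := (1 - ui_val w.2) * ui_val (f w.1) + ui_val w.2 * ui_val (g w.1).
have hE w : f w.1 = g w.1 -> ui_clamp (h w) = f w.1.
  by move=> E; rewrite /h -E -mulrDl subrK mul1r ui_valK.
exists (fun w => k (ui_clamp (h w))); split.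
- apply: lim_continuous_comp (@loop_continuous _ _ _ k).
  have vc := lim_continuous_comp (@lim_continuous_snd (unit_interval R)
    (unit_interval R)) (@lim_continuous_uival R).
  have cc e : lim_continuous e -> lim_continuous
      (fun w : unit_interval R * unit_interval R =>
         ui_val (e w.1) : top_limit R).
    move=> ec; apply: lim_continuous_comp (@lim_continuous_uival R).
    exact: lim_continuous_comp (@lim_continuous_fst _ _) ec.
  apply: lim_continuous_clamp; apply: lim_continuous_add;
    apply: lim_continuous_mul; do ?exact: cc; last exact: vc.
  apply: lim_continuous_add; first exact: lim_continuous_cst.
  exact: lim_continuous_opp vc.
- by move=> s; rewrite lE /h /= ui_val0 subr0 mul1r mul0r addr0 ui_valK.
- by move=> s; rewrite mE /h /= ui_val1 subrr mul0r add0r mul1r ui_valK.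
- move=> t; rewrite !hE//=.
  by have := lE ui0; have := lE ui1; rewrite /= loop_source loop_target.
Qed.

Lemma loop_cat_homotopic l l' m m' : loop_homotopic l l' ->
  loop_homotopic m m' -> loop_homotopic (loop_cat l m) (loop_cat l' m').
Proof.
move=> [H [Hc H0 H1 Hb]] [K [Kc K0 K1 Kb]].
exists (fun w => if ui_val w.1 <= 2^-1 then H (ui_clamp (2 * ui_val w.1), w.2)
                 else K (ui_clamp (2 * ui_val w.1 - 1), w.2)).
split.
- apply: (lim_continuous_glue (u := fun w => ui_val w.1) (v := fun=> 2^-1)).
  + exact: lim_continuous_comp (@lim_continuous_fst _ _)
      (@lim_continuous_uival R).
  + exact: lim_continuous_cst.
  + apply: lim_continuous_comp Hc; apply: lim_continuous_pair;
      last exact: lim_continuous_snd.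
    exact: (scale_cont 2 (@lim_continuous_fst _ _)).
  + apply: lim_continuous_comp Kc; apply: lim_continuous_pair;
      last exact: lim_continuous_snd.
    exact: (aff_cont 2 (- 1) (@lim_continuous_fst _ _)).
  + by move=> w /= ->; rewrite divff ?pnatr_eq0// subrr (Hb _).2 (Kb _).1.
- by move=> s /=; rewrite H0 K0.
- by move=> s /=; rewrite H1 K1.
- move=> t /=; split.
    by rewrite ui_val0 invr_ge0 ler0n mulr0 (Hb _).1.
  rewrite ui_val1 ifF ?mulr1; last by apply/negbTE; lra.
  by rewrite ui_clamp_ge1 ?(Kb _).2//; lra.
Qed.

Lemma loop_inv_homotopic l l' :
  loop_homotopic l l' -> loop_homotopic (loop_inv l) (loop_inv l').
Proof.
move=> [H [Hc H0 H1 Hb]]; exists (fun w => H (ui_clamp (1 - ui_val w.1), w.2)).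
split=> //.
- apply: lim_continuous_comp Hc; apply: lim_continuous_pair;
    last exact: lim_continuous_snd.
  apply: lim_continuous_clamp; apply: lim_continuous_add.
    exact: lim_continuous_cst.
  apply: lim_continuous_opp.
  exact: lim_continuous_comp (@lim_continuous_fst _ _)
    (@lim_continuous_uival R).
- by move=> t /=; rewrite ui_val0 ui_val1 subr0 subrr; case: (Hb t).
Qed.

Lemma loop_cst_cat l : loop_homotopic (loop_cat loop_cst l) l.
Proof.
apply: (@loop_reparam l (fun s => ui_clamp (2 * ui_val s - 1)) id) => //.
- exact: (aff_cont 2 (- 1) (@lim_continuous_id _)).
- by rewrite ui_val0 ui_clamp_le0//; lra.
- by rewrite ui_val1 ui_clamp_ge1//; lra.
- move=> s /=; rewrite /loop_cat_fun; case: leP => //= s2.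
  by rewrite ui_clamp_le0 ?loop_source//; lra.
Qed.

Lemma loop_cat_cst l : loop_homotopic (loop_cat l loop_cst) l.
Proof.
apply: (@loop_reparam l (fun s => ui_clamp (2 * ui_val s)) id) => //.
- exact: (scale_cont 2 (@lim_continuous_id _)).
- by rewrite ui_val0 ui_clamp_le0//; lra.
- by rewrite ui_val1 ui_clamp_ge1//; lra.
- move=> s /=; rewrite /loop_cat_fun; case: leP => //= s2.
  by rewrite ui_clamp_ge1 ?loop_target//; lra.
Qed.

Let dist_cont : lim_continuous
  (fun s : unit_interval R => `|2 * ui_val s - 1| : top_limit R).
Proof.
apply: lim_continuous_norm; apply: lim_continuous_add;
  last exact: lim_continuous_cst.
apply: lim_continuous_mul; first exact: lim_continuous_cst.
exact: lim_continuous_uival.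
Qed.

Lemma loop_inv_cat l : loop_homotopic (loop_cat (loop_inv l) l) loop_cst.
Proof.
apply: (@loop_reparam l (fun s => ui_clamp `|2 * ui_val s - 1|) (fun=> ui1)).
- exact: lim_continuous_clamp dist_cont.
- exact: lim_continuous_cst.
- by rewrite ui_val0 mulr0 sub0r normrN normr1.
- by rewrite ui_val1 mulr1 (_ : 2 - 1 = 1) ?normr1//; lra.
- move=> s /=; rewrite /loop_cat_fun /= /loop_inv_fun.
  have /andP[s0 s1] := ui_val_bounds s.
  case: leP => s2.
    by rewrite ui_clampE ?ler0_norm ?opprB//; lra.
  by rewrite ger0_norm//; lra.
- by move=> s /=; rewrite loop_target.
Qed.

Lemma loop_cat_inv l : loop_homotopic (loop_cat l (loop_inv l)) loop_cst.
Proof.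
apply: (@loop_reparam l (fun s => ui_clamp (1 - `|2 * ui_val s - 1|))
  (fun=> ui0)).
- apply: lim_continuous_clamp; apply: lim_continuous_add.
    exact: lim_continuous_cst.
  exact: lim_continuous_opp dist_cont.
- exact: lim_continuous_cst.
- by rewrite ui_val0 mulr0 sub0r normrN normr1 subrr.
- by rewrite ui_val1 mulr1 (_ : 2 - 1 = 1) ?normr1 ?subrr//; lra.
- move=> s /=; rewrite /loop_cat_fun /= /loop_inv_fun.
  have /andP[s0 s1] := ui_val_bounds s.
  case: leP => s2.
    by rewrite ler0_norm ?opprB; [congr (l (ui_clamp _)); lra|lra].
  by rewrite ui_clampE ?ger0_norm//; lra.
- by move=> s /=; rewrite loop_source.
Qed.

Lemma loop_catA l m n :
  loop_homotopic (loop_cat l (loop_cat m n)) (loop_cat (loop_cat l m) n).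
Proof.
pose f (s : unit_interval R) : R := if ui_val s <= 2^-1 then 2^-1 * ui_val s
  else if ui_val s <= 3 / 4 then ui_val s - 4^-1 else 2 * ui_val s - 1.
apply: (@loop_reparam (loop_cat (loop_cat l m) n) (fun s => ui_clamp (f s)) id).
- have vc := @lim_continuous_uival R.
  apply: lim_continuous_clamp.
  apply: (lim_continuous_glue (u := @ui_val R) (v := fun=> 2^-1)) => //.
  + exact: lim_continuous_cst.
  + by apply: lim_continuous_mul => //; exact: lim_continuous_cst.
  + apply: (lim_continuous_glue (u := @ui_val R) (v := fun=> 3 / 4)) => //.
    * exact: lim_continuous_cst.
    * by apply: lim_continuous_add => //; exact: lim_continuous_cst.
    * apply: lim_continuous_add; last exact: lim_continuous_cst.
      by apply: lim_continuous_mul => //; exact: lim_continuous_cst.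
    * by move=> s /= ->; lra.
  + by move=> s /= ->; rewrite ifT; lra.
- exact: lim_continuous_id.
- by rewrite /f ui_val0 invr_ge0 ler0n mulr0.
- rewrite /f ui_val1 !ifF; [|apply/negbTE; lra..].
  by rewrite ui_clamp_ge1//; lra.
- move=> s /=; rewrite /loop_cat_fun /= /loop_cat_fun /f.
  have /andP[s0 s1] := ui_val_bounds s.
  case: leP => s2.
    rewrite (@ui_clampE _ (2^-1 * _)); last lra.
    rewrite ifT; last lra.
    rewrite mulrA divff ?pnatr_eq0// mul1r ui_valK ifT//.
  rewrite (@ui_clampE _ (2 * _ - 1)); last lra.
  case: (leP (ui_val s) (3 / 4)) => s3.
    rewrite (@ui_clampE _ (ui_val s - _)); last lra.
    rewrite ifT; last lra.
    rewrite ifT; last lra.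
    rewrite (@ui_clampE _ (2 * (ui_val s - _))); last lra.
    rewrite ifF; last by apply/negbTE; lra.
    by congr (m (ui_clamp _)); lra.
  rewrite ifF; last by apply/negbTE; lra.
  rewrite (@ui_clampE _ (2 * _ - 1)); last lra.
  by rewrite ifF//; apply/negbTE; lra.
- by [].
Qed.

Definition loop_eqv : rel (loop R x) := fun l m => `[< loop_homotopic l m >].

Fact loop_eqv_refl : reflexive loop_eqv.
Proof. by move=> l; exact/asboolP/loop_homotopic_refl. Qed.

Fact loop_eqv_sym : symmetric loop_eqv.
Proof.
by move=> l m; apply/asboolP/asboolP; exact: loop_homotopic_sym.
Qed.

Fact loop_eqv_trans : transitive loop_eqv.
Proof.
by move=> m l n /asboolP lm /asboolP mn; apply/asboolP;
  exact: loop_homotopic_trans lm mn.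
Qed.

Canonical loop_equiv := EquivRel loop_eqv loop_eqv_refl loop_eqv_sym
  loop_eqv_trans.

Definition fundamental_group : Type := {eq_quot loop_equiv}.

HB.instance Definition _ := Choice.on fundamental_group.

Definition loop_class l : fundamental_group := \pi_({eq_quot loop_equiv}) l.
Definition loop_repr (a : fundamental_group) : loop R x :=
  repr (a : {eq_quot loop_equiv}).

Lemma loop_reprK : cancel loop_repr loop_class.
Proof. exact: reprK. Qed.

Lemma loop_classP l m : loop_class l = loop_class m <-> loop_homotopic l m.
Proof.
split=> [/eqmodP/asboolP//|lm]; exact/eqmodP/asboolP.
Qed.

Lemma loop_reprP l : loop_homotopic (loop_repr (loop_class l)) l.
Proof. by apply/loop_classP; rewrite loop_reprK. Qed.

Definition fg_one := loop_class loop_cst.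
Definition fg_inv a := loop_class (loop_inv (loop_repr a)).
Definition fg_mul a b := loop_class (loop_cat (loop_repr a) (loop_repr b)).

Lemma fg_mulE l m :
  fg_mul (loop_class l) (loop_class m) = loop_class (loop_cat l m).
Proof. exact/loop_classP/loop_cat_homotopic/loop_reprP/loop_reprP. Qed.

Lemma fg_invE l : fg_inv (loop_class l) = loop_class (loop_inv l).
Proof. exact/loop_classP/loop_inv_homotopic/loop_reprP. Qed.

Fact fg_mulA : associative fg_mul.
Proof.
move=> a b c; rewrite -(loop_reprK a) -(loop_reprK b) -(loop_reprK c) !fg_mulE.
exact/loop_classP/loop_catA.
Qed.

Fact fg_mul1g : left_id fg_one fg_mul.
Proof.
by move=> a; rewrite -(loop_reprK a) fg_mulE; exact/loop_classP/loop_cst_cat.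
Qed.

Fact fg_mulg1 : right_id fg_one fg_mul.
Proof.
by move=> a; rewrite -(loop_reprK a) fg_mulE; exact/loop_classP/loop_cat_cst.
Qed.

Fact fg_mulVg : left_inverse fg_one fg_inv fg_mul.
Proof.
move=> a; rewrite -(loop_reprK a) fg_invE fg_mulE.
exact/loop_classP/loop_inv_cat.
Qed.

Fact fg_mulgV : right_inverse fg_one fg_inv fg_mul.
Proof.
move=> a; rewrite -(loop_reprK a) fg_invE fg_mulE.
exact/loop_classP/loop_cat_inv.
Qed.

HB.instance Definition _ := isGroup.Build fundamental_group
  fg_mulA fg_mul1g fg_mulg1 fg_mulVg fg_mulgV.
End loops.

Section induced.
Variables (R : realType) (X Y : limitSpaceType) (x : X) (y : Y).
Variable g : based_map x y.

Fact loop_map_source (l : loop R x) : g (l ui0) = y.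
Proof. by rewrite loop_source based_point. Qed.

Fact loop_map_target (l : loop R x) : g (l ui1) = y.
Proof. by rewrite loop_target based_point. Qed.

Definition loop_map (l : loop R x) : loop R y :=
  @Loop R Y y (g \o l)
    (lim_continuous_comp (@loop_continuous _ _ _ l)
       (@based_continuous _ _ _ _ g))
    (loop_map_source l) (loop_map_target l).

Lemma loop_map_homotopic l m :
  loop_homotopic l m -> loop_homotopic (loop_map l) (loop_map m).
Proof.
move=> [H [Hc H0 H1 Hb]]; exists (g \o H); split.
- exact: lim_continuous_comp Hc (@based_continuous _ _ _ _ g).
- by move=> s /=; rewrite H0.
- by move=> s /=; rewrite H1.
- by move=> t /=; rewrite (Hb t).1 (Hb t).2 based_point.
Qed.

Definition induced (a : fundamental_group R x) : fundamental_group R y :=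
  loop_class (loop_map (loop_repr a)).

Lemma inducedE l : induced (loop_class l) = loop_class (loop_map l).
Proof. exact/loop_classP/loop_map_homotopic/loop_reprP. Qed.

Fact induced_monoid_morphism : monoid.monoid_morphism induced.
Proof.
split.
  rewrite [LHS]inducedE; apply/loop_classP.
  apply: (@loop_reparam R Y y (loop_cst R y) id id) => // s /=.
  exact: based_point.
move=> a b; rewrite -(loop_reprK a) -(loop_reprK b).
set l := loop_repr a; set m := loop_repr b.
have mulE (Z : limitSpaceType) (z : Z) (u v : loop R z) :
  (loop_class u * loop_class v)%g = loop_class (loop_cat u v) := fg_mulE u v.
rewrite mulE !inducedE mulE; apply/loop_classP.
apply: (@loop_reparam R Y y (loop_cat (loop_map l) (loop_map m)) id id) => //.
by move=> s /=; rewrite /loop_cat_fun /=; case: ifP.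
Qed.

HB.instance Definition _ := isUMagmaMorphism.Build
  (fundamental_group R x) (fundamental_group R y) induced
  induced_monoid_morphism.
End induced.

Arguments induced R {X Y x y} g.

(* Main.v *)
Require Import Defs.
From HB Require Import structures.
From mathcomp Require Import all_boot all_order all_algebra.
From mathcomp Require Import lra.
From mathcomp Require Import boolp classical_sets functions filter reals.
From mathcomp Require Import topology normedtype.

(** Evaluation on the space of paths issued from [y0], with the structure of
    continuous convergence, is jointly continuous, so [f] composed with it is a
    homotopy starting at a constant map and lifts along [p]. By unique path
    lifting and the condition on fundamental groups, the end of the lifted
    homotopy at a path depends only on the end point of that path; this defines
    [f']. It is continuous because, [Y] being locally path-connected, every
    filter converging in [Y] refines the image under the end point map of a
    filter converging in the path space. *)

Set Implicit Arguments.
Unset Strict Implicit.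
Unset Printing Implicit Defensive.

Import Order.TTheory GRing.Theory Num.Theory.

Local Open Scope classical_set_scope.
Local Open Scope ring_scope.

(** * Concatenation and reversal of paths *)

Section path_operations.
Variables (R : realType) (Y : limitSpaceType).
Implicit Types g h : unit_interval R -> Y.

Lemma lim_continuous_ui_affine (c d : R) : lim_continuous
  (fun s : unit_interval R => ui_clamp (c * ui_val s + d)).
Proof.
apply: lim_continuous_clamp; apply: lim_continuous_add;
  last exact: lim_continuous_cst.
apply: lim_continuous_mul; first exact: lim_continuous_cst.
exact: lim_continuous_uival.
Qed.

(** The [+ 0] gives both reparametrizations the affine form of [lim_continuous_ui_affine]. *)
Definition path_cat g h (s : unit_interval R) :=
  if ui_val s <= 2^-1 then g (ui_clamp (2 * ui_val s + 0))
  else h (ui_clamp (2 * ui_val s + -1)).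

Lemma path_cat_continuous g h : lim_continuous g -> lim_continuous h ->
  g ui1 = h ui0 -> lim_continuous (path_cat g h).
Proof.
move=> gc hc gh.
apply: (lim_continuous_glue (u := @ui_val R) (v := fun=> 2^-1)).
- exact: lim_continuous_uival.
- exact: lim_continuous_cst.
- exact: lim_continuous_comp (lim_continuous_ui_affine 2 0) gc.
- exact: lim_continuous_comp (lim_continuous_ui_affine 2 (-1)) hc.
- by move=> s /= ->; rewrite divff ?pnatr_eq0// subrr addr0 gh.
Qed.

Lemma path_cat0 g h : path_cat g h ui0 = g ui0.
Proof. by rewrite /path_cat ui_val0 invr_ge0 ler0n mulr0 addr0. Qed.

Lemma path_cat1 g h : path_cat g h ui1 = h ui1.
Proof.
rewrite /path_cat ui_val1 ifF; last by apply/negbTE; lra.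
by rewrite ui_clamp_ge1//; lra.
Qed.

Lemma path_cat_left g h s :
  path_cat g h (ui_clamp (2^-1 * ui_val s + 0)) = g s.
Proof.
have sb := ui_val_bounds s; move/andP: (sb) => [s0 s1].
rewrite /path_cat ui_clampE; last lra.
rewrite ifT; last lra.
by rewrite (_ : 2 * _ + 0 = ui_val s) ?ui_valK//; lra.
Qed.

Lemma path_cat_right g h s : g ui1 = h ui0 ->
  path_cat g h (ui_clamp (2^-1 * ui_val s + 2^-1)) = h s.
Proof.
move=> gh; have sb := ui_val_bounds s; move/andP: (sb) => [s0 s1].
rewrite /path_cat ui_clampE; last lra.
(* The midpoint belongs to the first half, so for [s = ui0] the value is read off [g] and [gh] is
   needed. *)
case: leP => s2.
  have z : ui_val s = 0 by lra.
  have -> : s = ui0 by apply/ui_val_inj; rewrite z ui_val0.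
  by rewrite ui_val0 ui_clamp_ge1//; lra.
by rewrite (_ : 2 * _ + -1 = ui_val s) ?ui_valK//; lra.
Qed.

Definition path_rev g (s : unit_interval R) := g (ui_clamp (-1 * ui_val s + 1)).

Lemma path_rev_continuous g : lim_continuous g -> lim_continuous (path_rev g).
Proof.
by move=> gc; exact: lim_continuous_comp (lim_continuous_ui_affine _ _) gc.
Qed.

Lemma path_rev0 g : path_rev g ui0 = g ui1.
Proof. by rewrite /path_rev ui_val0 mulr0 add0r. Qed.

Lemma path_rev1 g : path_rev g ui1 = g ui0.
Proof. by rewrite /path_rev ui_val1 mulr1 addNr. Qed.

Lemma path_revK g : path_rev (path_rev g) = g.
Proof.
apply/funext => s; have sb := ui_val_bounds s; move/andP: (sb) => [s0 s1].
rewrite /path_rev ui_clampE; last lra.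
by rewrite (_ : _ + 1 = ui_val s) ?ui_valK//; lra.
Qed.

End path_operations.

(** * The space of based paths and its evaluation map *)

Section path_space.
Variables (R : realType) (Y : limitSpaceType) (y0 : Y).

Record based_path := BasedPath {
  path_fun :> unit_interval R -> Y;
  path_continuous : lim_continuous path_fun;
  path_source : path_fun ui0 = y0
}.

Definition path_eval (w : based_path * unit_interval R) : Y := w.1 w.2.

(** The coarsest limit structure for which evaluation is jointly continuous. *)
Definition path_converges (F : set_system based_path) (w : based_path) :=
  ProperFilter F /\ forall J s, converges J s ->
    converges (fmap path_eval (filter_prod F J)) (w s).

Fact path_converges_proper F w : path_converges F w -> ProperFilter F.
Proof. by case. Qed.

Fact path_converges_principal w : path_converges (principal_filter w) w.
Proof.
have pw := principal_filter_proper w; split=> // J s Js.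
have JF := converges_proper Js.
apply: converges_finer (@path_continuous w _ _ Js) _ _.
move=> A JA; exists ([set w], [set t | A (w t)]); first by split.
by move=> [_ t] [/= -> At].
Qed.

Fact path_converges_cap F G w :
  path_converges F w -> path_converges G w -> path_converges (F `&` G) w.
Proof.
move=> [F0 Fw] [G0 Gw]; have FG0 := proper_cap F0 G0; split=> // J s Js.
have JF := converges_proper Js.
apply: converges_finer (converges_cap (Fw _ _ Js) (Gw _ _ Js)) _ _.
move=> A [[[P Q] [/= FP JQ] PQ] [[P' Q'] [/= GP' JQ'] PQ']].
(* The union of the path factors lies in both filters; only the time factors have to be
   intersected. *)
exists (P `|` P', Q `&` Q') => /=.
  split; last exact: filterI.
  by split; [apply: filterS FP => v; left | apply: filterS GP' => v; right].
by move=> [v t] [/= [Pv|P'v] [Qt Q't]]; [exact: PQ | exact: PQ'].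
Qed.

Fact path_converges_finer F G w :
  path_converges F w -> ProperFilter G -> F `<=` G -> path_converges G w.
Proof.
move=> [F0 Fw] G0 FG; split=> // J s Js; have JF := converges_proper Js.
apply: converges_finer (Fw _ _ Js) _ _.
by move=> A [PQ [FP JQ] sub]; exists PQ => //; split=> //; exact: FG.
Qed.

HB.instance Definition _ := isLimitSpace.Build based_path
  path_converges_proper path_converges_principal
  path_converges_cap path_converges_finer.

Lemma path_eval_continuous : lim_continuous path_eval.
Proof.
move=> K [w s] [K0 [_ Kw] Ks].
(* A filter on the product is finer than the product of its two projections. *)
apply: converges_finer (Kw _ _ Ks) (proper_fmap _ K0) _.
move=> A [[P Q] [/= KP KQ] PQ].
by apply: (@filterS2 _ K _ _ _ _ _ KP KQ) => -[v t] Pv Qt; exact: PQ.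
Qed.

Definition path_end (w : based_path) : Y := w ui1.

End path_space.

(** * Lifting points and convergent filters along the end point map *)

Section local_path_connectedness.
Variables (R : realType) (Y : limitSpaceType) (y0 : Y).
Hypothesis Y_lpc : lim_locally_path_connected R Y.

(** Otherwise the set [A] of end points and its complement disconnect [Y]: a path-connected set
    meeting [A] lies in [A], since a path inside it can be appended, and every convergent filter
    contains a path-connected set. *)
Lemma connected_path_end_surj : lim_connected Y ->
  forall y, exists w : based_path R y0, path_end w = y.
Proof.
move=> Yc; pose A := [set y | exists w : based_path R y0, path_end w = y].
suff : ~` A = set0.
  by rewrite -[set0]setCT => /setC_inj AT y; have : A y by rewrite AT.
apply: contrapT => /eqP/set0P nA; apply: Yc.
exists A, (~` A); split=> //; [|exact: setICr|exact: setUv|].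
  exists y0.
  by exists (BasedPath (@lim_continuous_cst (unit_interval R) Y y0) erefl).
exists [set C | C `<=` A \/ C `<=` ~` A] => // x F Fx.
have [B Bx Bpc] := Y_lpc x.
have [G [Gx GF GB]] := Bx _ Fx.
have [C [BC GC _]] := GB setT (@filterT _ _ (converges_proper Gx)).
exists C; split; last exact: GF.
have [[a [Ca [w wa]]]|CA] := pselect (C `&` A !=set0); last first.
  by right=> z Cz Az; apply: CA; exists z.
left=> z Cz.
have [g [gc g0 g1]] :=
  Bpc C BC (exist _ a (mem_set Ca)) (exist _ z (mem_set Cz)).
have vc := lim_continuous_comp gc (@lim_continuous_val _ C).
have E : w ui1 = (val \o g) ui0 by rewrite /= g0.
have S : path_cat w (val \o g) ui0 = y0 by rewrite path_cat0 path_source.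
exists (BasedPath (path_cat_continuous (@path_continuous _ _ _ w) vc E) S).
by rewrite /path_end /= path_cat1 /= g1.
Qed.

Section path_filter.
Variables (w0 : based_path R y0) (F : set_system Y).
Hypotheses (Fy : converges F (path_end w0))
  (Fpt : forall A, F A -> A (path_end w0)).

(** Only the second half of a path varies; freezing the first half makes the resulting filter
    converge at early times. *)
Definition path_tails (A : set Y) : set (based_path R y0) :=
  [set w : based_path R y0 |
    (forall s, ui_val s <= 2^-1 -> w s = w0 (ui_clamp (2 * ui_val s + 0))) /\
    (forall s, 2^-1 < ui_val s -> A (w s))].

Definition path_filter : set_system (based_path R y0) :=
  filter_from F path_tails.

Lemma path_tails_cat A g : lim_continuous g -> g ui0 = path_end w0 ->
  (forall s, A (g s)) ->
  exists2 w, path_tails A w & path_cat w0 g = w.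
Proof.
move=> gc g0 Ag.
have S : path_cat w0 g ui0 = y0 by rewrite path_cat0 path_source.
have c := path_cat_continuous (@path_continuous _ _ _ w0) gc (esym g0).
exists (BasedPath c S) => //.
split=> s; rewrite /= /path_cat; first by move=> ->.
by rewrite ltNge => /negbTE ->.
Qed.

Lemma path_filter_converges :
  exists2 w, path_end w = path_end w0 & converges path_filter w.
Proof.
have F0 := converges_proper Fy.
(* The limit is [w0] followed by the constant path at its end. *)
have [w wT wE] := path_tails_cat (A := [set path_end w0])
  (@lim_continuous_cst (unit_interval R) Y (path_end w0)) erefl (fun=> erefl).
exists w; first by rewrite {1}/path_end -wE path_cat1.
have pF : ProperFilter path_filter.
  apply: filter_from_proper => [|A FA].
    apply: filter_from_filter; first by exists setT; exact: filterT.
    move=> A A' FA FA'; exists (A `&` A'); first exact: filterI.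
    by move=> v [vl vr]; split; split=> // s /vr[].
  (* By [Fpt] the constant tail stays in [A], so no generating set is empty. *)
  have [v vA _] := path_tails_cat
    (@lim_continuous_cst (unit_interval R) Y (path_end w0)) erefl
    (fun=> Fpt FA).
  by exists v.
split=> // J s Js; have JF := converges_proper Js.
have pP := proper_fmap (@path_eval R Y y0) (@filter_prod_proper _ _ _ _ pF JF).
have wJ := @path_continuous _ _ _ w _ _ Js.
have sJ := (lim_continuous_realP _).1 (@lim_continuous_uival R) _ _ Js.
(* Strictly before the midpoint, all the paths agree with [w] at times near [s]. *)
have [s2|s2] := ltP (ui_val s) 2^-1.
  apply: converges_finer wJ pP _ => A wA.
  have J2 : \forall t \near J, ui_val t < 2^-1.
    exact: (@cvgr_lt _ _ _ _ _ _ sJ 2^-1 s2).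
  exists (path_tails setT, [set t | A (w t) /\ ui_val t < 2^-1]).
    split; first by exists setT => //; exact: filterT.
    exact: filterI.
  move=> [v t] [[vl _] [Awt /ltW t2]].
  by rewrite /path_eval /= vl// -wT.1.
have wsE : w s = path_end w0.
  have [s3|s3] := ltP 2^-1 (ui_val s); first exact: wT.2.
  by rewrite wT.1// ui_clamp_ge1//; lra.
(* From the midpoint on, a path evaluated near [s] takes the value [w t] or one in [A], so the image
   is finer than the intersection of [F] with the image of [J] under [w]. *)
have := converges_cap Fy; rewrite -wsE => /(_ _ wJ) Fw.
apply: converges_finer Fw pP _ => A [FA wA].
exists (path_tails A, [set t | A (w t)]); first by split=> //; exists A.
move=> [v t] [[vl vr] Awt]; rewrite /path_eval /=.
by have [t2|/vr//] := leP (ui_val t) 2^-1; rewrite vl// -wT.1.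
Qed.

End path_filter.

(* [path_end] is a quotient map of limit spaces onto the path component. *)
Lemma path_end_lift_filter (w0 : based_path R y0) H :
  converges H (path_end w0) ->
  exists G w, [/\ converges G w, path_end w = path_end w0 &
    fmap (@path_end R Y y0) G `<=` H].
Proof.
move=> Hy; have [B By Bpc] := Y_lpc (path_end w0).
(* The principal filter puts the limit into every member of [F]. *)
have [F [Fy FH FB]] := By _ (converges_cap Hy (converges_principal _)).
have Fpt A : F A -> A (path_end w0) by move=> /FH[_]; exact.
have [w wE Gw] := path_filter_converges Fy Fpt.
exists (path_filter w0 F), w; split=> // A [D FD DA].
have [C [BC FC CD]] := FB _ FD; have FF := converges_proper Fy.
(* Each point of [C] ends a path that follows [w0] and then stays in [C], hence in [D]. *)
suff CA : C `<=` A by exact: (FH A (filterS CA FC)).1.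
have Cy := Fpt _ FC; move=> z Cz.
have [g [gc g0 g1]] :=
  Bpc C BC (exist _ (path_end w0) (mem_set Cy)) (exist _ z (mem_set Cz)).
have vc := lim_continuous_comp gc (@lim_continuous_val _ C).
have E : (val \o g) ui0 = path_end w0 by rewrite /= g0.
have [v vD vE] := path_tails_cat vc E (fun s => CD _ (set_mem (valP (g s)))).
by have := DA v vD; rewrite /= /path_end -vE path_cat1 /= g1.
Qed.

End local_path_connectedness.

(** * Lifting constant paths and loops *)

Section fibration.
Variables (R : realType) (E B : limitSpaceType) (e0 : E) (b0 : B).
Variable p : based_map e0 b0.
Hypotheses (p_fib : lim_fibration R p) (p_upl : unique_path_lifting R p).

Lemma lift_constant_path (w : unit_interval R -> E) : lim_continuous w ->
  (forall s, p (w s) = p (w ui0)) -> forall s, w s = w ui0.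
Proof.
move=> wc wp s.
suff -> : w = fun=> w ui0 by [].
by apply: p_upl => //; [exact: lim_continuous_cst | apply/funext].
Qed.

(** Lift a homotopy from [p \o m] to [l], starting at [m]. Its two sides lie over constant paths,
    hence are constant, so its final stage is a loop over [l]. *)
Lemma lift_loop_of_range (l : loop R b0) :
  range (induced R p) (loop_class l) -> exists m : loop R e0, p \o m = l.
Proof.
move=> [a _]; rewrite -(loop_reprK a) inducedE.
set m := loop_repr a => /loop_classP[H [Hc H0 H1 Hb]].
have [H' [H'c H'0 H'p]] := p_fib.2 _ m H (@loop_continuous _ _ _ m) Hc H0.
have side s t : (forall r, H (s, r) = b0) -> H' (s, t) = m s.
  move=> Hs; rewrite -H'0.
  have c : lim_continuous (fun r : unit_interval R => H' (s, r)).
    apply: lim_continuous_comp H'c; apply: lim_continuous_pair.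
      exact: lim_continuous_cst.
    exact: lim_continuous_id.
  by apply: (lift_constant_path c) => r; rewrite !H'p !Hs.
have m0 : H' (ui0, ui1) = e0.
  by rewrite side ?loop_source// => r; exact: (Hb r).1.
have m1 : H' (ui1, ui1) = e0.
  by rewrite side ?loop_target// => r; exact: (Hb r).2.
have mc : lim_continuous (fun s : unit_interval R => H' (s, ui1)).
  apply: lim_continuous_comp H'c; apply: lim_continuous_pair.
    exact: lim_continuous_id.
  exact: lim_continuous_cst.
by exists (Loop mc m0 m1); apply/funext => s /=; rewrite H'p H1.
Qed.

End fibration.

(** * Independence of the chosen path, and the lifting criterion *)

(** The image under [f] of [v] followed by the reverse of [w] lifts to a loop [m]. By uniqueness
    [v'] is the first half of [m] and [w'] the reversed second half, so both end at the midpoint of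
    [m]. *)
Lemma lifted_ends_eq (R : realType) (X Xt Y : limitSpaceType)
    (x0 : X) (xt0 : Xt) (y0 : Y) (p : based_map xt0 x0)
    (p_fib : lim_fibration R p) (p_upl : unique_path_lifting R p)
    (f : based_map y0 x0) (v w : based_path R y0) (v' w' : based_path R xt0) :
  range (induced R f) `<=` range (induced R p) ->
  p \o v' = f \o v -> p \o w' = f \o w ->
  path_end v = path_end w -> path_end v' = path_end w'.
Proof.
move=> fp v'E w'E vw.
have E : v ui1 = path_rev w ui0 by rewrite path_rev0.
have c := path_cat_continuous (@path_continuous _ _ _ v)
  (path_rev_continuous (@path_continuous _ _ _ w)) E.
have s0 : path_cat v (path_rev w) ui0 = y0 by rewrite path_cat0 path_source.
have s1 : path_cat v (path_rev w) ui1 = y0.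
  by rewrite path_cat1 path_rev1 path_source.
have [m mE] : exists m : loop R xt0, p \o m = loop_map f (Loop c s0 s1).
  apply: (lift_loop_of_range p_fib p_upl); apply: fp.
  by exists (loop_class (Loop c s0 s1)); rewrite ?inducedE.
have mc := @loop_continuous _ _ _ m.
have h2 : 2^-1 * 1 + 2^-1 = 1 :> R by lra.
pose m1 s := m (ui_clamp (2^-1 * ui_val s + 0)).
pose m2 s := m (ui_clamp (2^-1 * ui_val s + 2^-1)).
have m1c : lim_continuous m1.
  exact: lim_continuous_comp (lim_continuous_ui_affine _ _) mc.
have m2c : lim_continuous m2.
  exact: lim_continuous_comp (lim_continuous_ui_affine _ _) mc.
have v'm : v' = m1 :> (_ -> _).
  apply: p_upl => //; first exact: path_continuous.
    rewrite v'E; apply/funext => s.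
    have /= := congr1 (fun h => h (ui_clamp (2^-1 * ui_val s + 0))) mE.
    by rewrite path_cat_left /m1 /= => ->.
  by rewrite path_source /m1 ui_val0 mulr0 add0r [RHS]loop_source.
(* The two lifts start at the same point because [m] closes up at [xt0]. *)
have w'm : w' = path_rev m2 :> (_ -> _).
  apply: p_upl => //; [exact: path_continuous|exact: path_rev_continuous|..].
    rewrite w'E; apply/funext => s; rewrite -{1}(path_revK w) /=.
    set r := ui_clamp (-1 * ui_val s + 1).
    have /= := congr1 (fun h => h (ui_clamp (2^-1 * ui_val r + 2^-1))) mE.
    by rewrite (path_cat_right _ E) /path_rev /m2 /= => ->.
  by rewrite path_source path_rev0 /m2 ui_val1 h2 [RHS]loop_target.
rewrite /path_end v'm w'm path_rev1 /m1 /m2 ui_val0 ui_val1.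
by rewrite mulr0 mulr1 add0r addr0.
Qed.

Theorem theorem3p3p6 (R : realType) (X Xt Y : limitSpaceType)
    (x0 : X) (xt0 : Xt) (y0 : Y)
    (p : based_map xt0 x0) (p_fib : lim_fibration R p)
    (p_upl : unique_path_lifting R p)
    (Y_conn : lim_connected Y) (Y_lpc : lim_locally_path_connected R Y)
    (f : based_map y0 x0) :
  (exists f' : based_map y0 xt0, p \o f' = f :> (Y -> X)) <->
  range (induced R f) `<=` range (induced R p).
Proof.
split=> [[f' f'E] _ [a _ <-]|fp].
  (* The loops [p \o f' \o l] and [f \o l] agree pointwise, so the identity reparametrization
     relates them. *)
  exists (induced R f' a) => //; rewrite -(loop_reprK a) !inducedE.
  apply/loop_classP; apply: (@loop_reparam R X x0 _ id id) => // s /=.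
  by rewrite -f'E.
pose P := based_path R y0.
have start (w : P) : f (w ui0) = p xt0 by rewrite path_source !based_point.
(* The homotopy lifting property, with the path space as parameter space, lifts all the paths at
   once. *)
have [Ft [Ftc Ft0 Ftp]] := p_fib.2 P (fun=> xt0) (f \o @path_eval R Y y0)
  (@lim_continuous_cst P Xt xt0)
  (lim_continuous_comp (@path_eval_continuous R Y y0)
    (@based_continuous _ _ _ _ f))
  start.
have Ftwc (w : P) : lim_continuous (fun s : unit_interval R => Ft (w, s)).
  apply: lim_continuous_comp Ftc; apply: lim_continuous_pair.
    exact: lim_continuous_cst.
  exact: lim_continuous_id.
pose lift (w : P) := BasedPath (Ftwc w) (Ft0 w).
have liftE (w : P) : p \o lift w = f \o w by apply/funext => s; exact: Ftp.
have ends (v w : P) : path_end v = path_end w -> Ft (v, ui1) = Ft (w, ui1).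
  exact: (lifted_ends_eq p_fib p_upl fp (liftE v) (liftE w)).
have [q qE] := choice (connected_path_end_surj y0 Y_lpc Y_conn).
have f'c : lim_continuous (fun y => Ft (q y, ui1)).
  move=> H y Hy; rewrite -(qE y) in Hy.
  have [G [w [Gw wE GH]]] := path_end_lift_filter Y_lpc Hy.
  have Fec : lim_continuous (fun w : P => Ft (w, ui1)).
    apply: lim_continuous_comp Ftc; apply: lim_continuous_pair.
      exact: lim_continuous_id.
    exact: lim_continuous_cst.
  (* The choice [q] need not be continuous: by [ends], [q y] can be traded for the limit [w], and
     [q (path_end v)] for [v]. *)
  rewrite (ends _ _ (esym wE)).
  apply: converges_finer (Fec _ _ Gw) (proper_fmap _ (converges_proper Hy)) _.
  have GF := converges_proper Gw.
  move=> A GA; apply: GH; apply: (@filterS _ G _ _ _ _ GA) => v Av.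
  by rewrite /= (ends _ v).
have f'0 : Ft (q y0, ui1) = xt0.
  (* The constant path at [y0] lifts to a constant path, which fixes the value at the base point. *)
  pose cst := BasedPath (@lim_continuous_cst (unit_interval R) Y y0) erefl.
  rewrite (ends _ cst) ?qE// -(Ft0 cst).
  by apply: (lift_constant_path p_upl (Ftwc cst)) => s; rewrite !Ftp.
exists (BasedMap f'c f'0); apply/funext => y /=.
by rewrite Ftp /=; congr (f _); exact: qE.
Qed.
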